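(* Let $L$ be an infinitely distributive lattice and let $Y$ be a sublattice of $L$. Then the O-closure of $Y$ in $L$ and the $\mathfrak{u}$O-closure of $Y$ in $L$ coincide, and the resulting subset is again a sublattice of $L$.
   Context: A sublattice of $L$ is a subset closed under the binary joins and meets of $L$. A subset of a poset is directed (resp. filtered) if it is non-empty and each of its finite subsets has an upper bound (resp. lower bound) in it. A net $(x_\gamma)_{\gamma\in\Gamma}$ in a lattice $L$ O-converges to $x\in L$ if there exist a directed set $M\subseteq L$ and a filtered set $N\subseteq L$ with $\bigvee M=\bigwedge N=x$ such that for every $(m,n)\in M\times N$ there is $\gamma_0\in\Gamma$ with $m\le x_\gamma\le n$ for all $\gamma\ge\gamma_0$. The net $\mathfrak{u}$O-converges to $x$ if $((x_\gamma\wedge t)\vee s)_{\gamma\in\Gamma}$ O-converges to $(x\wedge t)\vee s$ for every $s,t\in L$ with $s\le t$. A lattice $L$ is infinitely distributive if for every $x\in L$ and every family $\{x_\alpha\}_{\alpha\in\mathcal A}\subseteq L$: whenever $\bigwedge_\alpha x_\alpha$ exists, $x\vee\bigwedge_\alpha x_\alpha=\bigwedge_\alpha(x\vee x_\alpha)$; and whenever $\bigvee_\alpha x_\alpha$ exists, $x\wedge\bigvee_\alpha x_\alpha=\bigvee_\alpha(x\wedge x_\alpha)$. For $X\subseteq L$, let $X_1^{O}$ (resp. $X_1^{\mathfrak{u}O}$) be the set of all $x\in L$ for which there is a net in $X$ that O-converges (resp. $\mathfrak{u}$O-converges) to $x$. $X$ is O-closed (resp. $\mathfrak{u}$O-closed)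 if $X=X_1^{O}$ (resp. $X=X_1^{\mathfrak{u}O}$). The O-closure (resp. $\mathfrak{u}$O-closure) of $X$ is the smallest O-closed (resp. $\mathfrak{u}$O-closed) subset of $L$ containing $X$. *)

(* Defs.v *)
From mathcomp Require Import all_boot all_order.
From mathcomp Require Import boolp classical_sets cardinality.

Set Implicit Arguments.
Unset Strict Implicit.
Unset Printing Implicit Defensive.

Import Order.LTheory.
Local Open Scope classical_set_scope.

(* With [le] the reverse of an order, [directed le D] says that [D] is
   filtered for that order. *)
Definition directed (T : Type) (le : T -> T -> Prop) (D : set T) : Prop :=
  D !=set0 /\
  forall F : set T, finite_set F -> F `<=` D ->
    exists2 z, D z & forall x, F x -> le x z.

(* The index of a net: antisymmetry is not required. *)
Record directed_index := DirectedIndex {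
  index_sort :> Type;
  index_le : index_sort -> index_sort -> Prop;
  index_le_refl : forall i, index_le i i;
  index_le_trans : forall i j k, index_le i j -> index_le j k -> index_le i k;
  index_directed : directed index_le setT }.

Section Lattice.
Context {d : Order.disp_t} {L : latticeType d}.
Implicit Types (X Y : set L) (x s t : L).

Definition sublattice Y : Prop :=
  forall x y, Y x -> Y y -> Y (Order.meet x y) /\ Y (Order.join x y).

(* As [supremums A] and [infimums A] have at most one element, [supremums A x]
   says that the supremum of [A] exists and equals [x]. *)
Definition infinitely_distributive : Prop :=
  forall (x : L) (A : Type) (f : A -> L),
    (forall m, infimums (range f) m ->
       infimums (range (fun a => Order.join x (f a))) (Order.join x m)) /\
    (forall m, supremums (range f) m ->
       supremums (range (fun a => Order.meet x (f a))) (Order.meet x m)).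

Definition O_cvg (I : directed_index) (u : I -> L) x : Prop :=
  exists M N : set L,
    [/\ directed (fun a b => (a <= b)%O) M,
        directed (fun a b => (b <= a)%O) N,
        supremums M x, infimums N x &
        forall m n, M m -> N n -> exists i0 : I,
          forall i, index_le i0 i -> (m <= u i <= n)%O].

Definition uO_cvg (I : directed_index) (u : I -> L) x : Prop :=
  forall s t, (s <= t)%O ->
    O_cvg (fun i => Order.join (Order.meet (u i) t) s)
          (Order.join (Order.meet x t) s).

Definition O_limits X : set L :=
  [set x | exists (I : directed_index) (u : I -> L),
             (forall i, X (u i)) /\ O_cvg u x].

Definition uO_limits X : set L :=
  [set x | exists (I : directed_index) (u : I -> L),
             (forall i, X (u i)) /\ uO_cvg u x].

Definition O_closed X : Prop := X = O_limits X.
Definition uO_closed X : Prop := X = uO_limits X.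

Definition O_closure X : set L := smallest O_closed X.
Definition uO_closure X : set L := smallest uO_closed X.

End Lattice.

Arguments infinitely_distributive {d} L.

(* [smallest] is an intersection; the lemmas below check that the closures are
   themselves closed, hence really the smallest closed sets. *)
Section ClosureIsClosed.
Context {d : Order.disp_t} {L : latticeType d}.
Implicit Types (X : set L).

Lemma directed1 (T : Type) (le : T -> T -> Prop) (x : T) :
  le x x -> directed le [set x].
Proof. by move=> xx; split; [exists x | move=> F _ Fx; exists x => // y /Fx ->]. Qed.

Lemma unit_directed : directed (fun _ _ : unit => True) setT.
Proof. by split; [exists tt | move=> F _ _; exists tt]. Qed.

Definition unit_index : directed_index :=
  @DirectedIndex unit (fun _ _ => True) (fun _ => I) (fun _ _ _ _ _ => I)
    unit_directed.

Lemma O_cvg_cst (I : directed_index) (x : L) : O_cvg (fun _ : I => x) x.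
Proof.
exists [set x], [set x]; split; rewrite ?supremums1 ?infimums1 //.
- exact: directed1.
- exact: directed1.
- move=> _ _ -> ->; have [[i _] _] := index_directed I.
  by exists i => j _; rewrite lexx.
Qed.

Lemma sub_O_limits X : X `<=` O_limits X.
Proof. by move=> x Xx; exists unit_index, (fun=> x); split => //; exact: O_cvg_cst. Qed.

Lemma sub_uO_limits X : X `<=` uO_limits X.
Proof.
move=> x Xx; exists unit_index, (fun=> x).
by split => // s t _; exact: O_cvg_cst.
Qed.

Lemma O_closure_closed X : O_closed (O_closure X).
Proof.
apply/seteqP; split; first exact: sub_O_limits.
move=> x [I [u [uX ux]]] A /= [Acl XA]; rewrite Acl.
by exists I, u; split => // i; apply: uX.
Qed.

Lemma uO_closure_closed X : uO_closed (uO_closure X).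
Proof.
apply/seteqP; split; first exact: sub_uO_limits.
move=> x [I [u [uX ux]]] A /= [Acl XA]; rewrite Acl.
by exists I, u; split => // i; apply: uX.
Qed.

End ClosureIsClosed.

(* Main.v *)
Require Import Defs.
From mathcomp Require Import all_boot all_order.
From mathcomp Require Import boolp classical_sets cardinality.

(** Infinite distributivity makes each translation [meet t] and [join s]
    preserve the suprema and infima that witness O-convergence, so both
    translations are O-continuous ([O_cvg_meet], [O_cvg_join]).  This has two
    consequences.

    First, O-convergence implies uO-convergence, so every uO-closed set is
    O-closed and the O-closure lies in the uO-closure.

    Second, the O-closure [C] of a sublattice [Y] is a sublattice: for fixed
    [z], the points [x] whose meet and join with [z] lie in [C] form an
    O-closed set; that set contains [Y] when [z] is in [Y], hence it contains
    [C], and then the same argument applies with [z] in [C].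

    The remaining inclusion follows from a fact valid in every lattice:
    a sublattice [C] that is O-closed is uO-closed
    ([O_closed_sublattice_uO_closed]).  Let a net [u] in [C] uO-converge to
    [x], and write [[s, t](x)] for [join (meet x t) s].  Truncation bounds
    [s <= t] taken in [C] keep the net inside [C], so [[s, t](x)] lies in [C].
    Bounds outside [C] are also usable as soon as the truncated net itself is
    known to stay in [C], and this permits reaching [x] in three steps, where
    [t] is in [C]:
    - with [s = meet (u j) t], the element [join (meet x t) (meet (u j) t)]
      lies in [C] for every index [j];
    - the same element is also the truncation of [u j] with lower bound
      [meet x t] and upper bound [t]; hence these elements, indexed by [j],
      O-converge to [meet x t], which therefore lies in [C];
    - with upper bound [x] and lower bound [meet x (u j)], the truncated net
      [join (meet (u i) x) (meet x (u j))] lies in [C] by the previous step,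
      and it O-converges to [x]. *)

Set Implicit Arguments.
Unset Strict Implicit.
Unset Printing Implicit Defensive.

Import Order.LTheory.
Local Open Scope classical_set_scope.

Lemma directed_image (T U : Type) (leT : T -> T -> Prop)
    (leU : U -> U -> Prop) (f : T -> U) (D : set T) :
  (forall a b, leT a b -> leU (f a) (f b)) ->
  directed leT D -> directed leU (f @` D).
Proof.
move=> fmono [[a0 Da0] dirD]; split; first by exists (f a0), a0.
move=> F finF FfD.
(* A preimage of [F] may be infinite; a section of [f] over [F] has a finite
   image. *)
have /choice[g gP] : forall y, exists a, F y -> D a /\ f a = y.
  move=> y; have [Fy|nFy] := pselect (F y); last by exists a0 => /nFy.
  by have [a Da fa] := FfD y Fy; exists a.
have [b Fb|z Dz gz] := dirD (g @` F) (finite_image g finF).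
  by case: Fb => y Fy <-; case: (gP y Fy).
exists (f z); first by exists z.
move=> y Fy; have [_ <-] := gP y Fy.
by apply: fmono; apply: gz; exists y.
Qed.

Section Translations.
Context {d : Order.disp_t} {L : latticeType d}.
Implicit Types (A X Y C : set L) (x s t : L).

Lemma infimums_meet A t x :
  A !=set0 -> infimums A x -> infimums (Order.meet t @` A) (Order.meet t x).
Proof.
move=> [a0 Aa0] [lbx glbx]; split.
  by move=> _ [a Aa <-]; rewrite leI2 // lbx.
move=> z lbz; rewrite lexI; apply/andP; split.
  have : (z <= Order.meet t a0)%O by apply: lbz; exists a0.
  by rewrite lexI => /andP[].
apply: glbx => a Aa.
have : (z <= Order.meet t a)%O by apply: lbz; exists a.
by rewrite lexI => /andP[].
Qed.

Lemma supremums_join A s x :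
  A !=set0 -> supremums A x -> supremums (Order.join s @` A) (Order.join s x).
Proof.
move=> [a0 Aa0] [ubx lubx]; split.
  by move=> _ [a Aa <-]; rewrite leU2 // ubx.
move=> z ubz; rewrite leUx; apply/andP; split.
  have : (Order.join s a0 <= z)%O by apply: ubz; exists a0.
  by rewrite leUx => /andP[].
apply: lubx => a Aa.
have : (Order.join s a <= z)%O by apply: ubz; exists a.
by rewrite leUx => /andP[].
Qed.

Lemma range_sval (T U : Type) (f : T -> U) (A : set T) :
  range (fun a : {a | A a} => f (sval a)) = f @` A.
Proof.
apply/seteqP; split => y.
  by move=> [[a Aa] _ /= <-]; exists a.
by move=> [a Aa <-]; exists (exist _ a Aa).
Qed.

Lemma supremums_meet (hL : infinitely_distributive L) A t x :
  supremums A x -> supremums (Order.meet t @` A) (Order.meet t x).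
Proof.
move=> supA; have [_] := hL t {a | A a} sval.
by rewrite (range_sval id) image_id range_sval; apply.
Qed.

Lemma infimums_join (hL : infinitely_distributive L) A s x :
  infimums A x -> infimums (Order.join s @` A) (Order.join s x).
Proof.
move=> infA; have [+ _] := hL s {a | A a} sval.
by rewrite (range_sval id) image_id range_sval; apply.
Qed.

(** Monotonicity makes the image of the bounding sets directed, filtered and
    bounding for the image net; preservation of the supremum and infimum then
    identifies its limit. *)
Lemma O_cvg_image (f : L -> L) (I : directed_index) (u : I -> L) x :
  (forall a b, (a <= b)%O -> (f a <= f b)%O) ->
  (forall M, M !=set0 -> supremums M x -> supremums (f @` M) (f x)) ->
  (forall N, N !=set0 -> infimums N x -> infimums (f @` N) (f x)) ->
  O_cvg u x -> O_cvg (fun i => f (u i)) (f x).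
Proof.
move=> fmono fsup finf [M [N [dirM dirN supM infN MuN]]].
exists (f @` M), (f @` N); split.
- exact: directed_image dirM.
- by apply: directed_image dirN => a b; apply: fmono.
- by apply: fsup supM; case: dirM.
- by apply: finf infN; case: dirN.
- move=> _ _ [m Mm <-] [n Nn <-]; have [i0 i0P] := MuN m n Mm Nn.
  by exists i0 => i /i0P /andP[mu un]; rewrite !fmono.
Qed.

Lemma O_cvg_meet (hL : infinitely_distributive L) (I : directed_index)
    (u : I -> L) t x :
  O_cvg u x -> O_cvg (fun i => Order.meet t (u i)) (Order.meet t x).
Proof.
apply: O_cvg_image => [a b ab|M _|N]; first by rewrite leI2.
- exact: supremums_meet.
- exact: infimums_meet.
Qed.

Lemma O_cvg_join (hL : infinitely_distributive L) (I : directed_index)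
    (u : I -> L) s x :
  O_cvg u x -> O_cvg (fun i => Order.join s (u i)) (Order.join s x).
Proof.
apply: O_cvg_image => [a b ab|M|N _]; first by rewrite leU2.
- exact: supremums_join.
- exact: infimums_join.
Qed.

Lemma O_cvg_uO_cvg (hL : infinitely_distributive L) (I : directed_index)
    (u : I -> L) x :
  O_cvg u x -> uO_cvg u x.
Proof.
move=> ux s t _; rewrite joinC meetC.
under eq_fun do rewrite joinC meetC.
exact/O_cvg_join/O_cvg_meet.
Qed.

Lemma O_closedP X : O_closed X <->
  forall (I : directed_index) (u : I -> L) x,
    (forall i, X (u i)) -> O_cvg u x -> X x.
Proof.
split=> [Xcl I u x Xu ux|Xlim]; first by rewrite Xcl; exists I, u.
apply/seteqP; split; first exact: sub_O_limits.
by move=> x [I [u [Xu ux]]]; apply: Xlim Xu ux.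
Qed.

Lemma uO_closed_O_closed (hL : infinitely_distributive L) X :
  uO_closed X -> O_closed X.
Proof.
move=> Xcl; apply/O_closedP => I u x Xu ux; rewrite Xcl.
by exists I, u; split=> //; apply: O_cvg_uO_cvg.
Qed.

(** The truncation bounds that recover the limit [x] depend on [x] itself and
    need not belong to [C]; the order in which they are used makes every
    truncated net stay in [C]. *)
Lemma O_closed_sublattice_uO_closed C :
  sublattice C -> O_closed C -> uO_closed C.
Proof.
move=> Clat /O_closedP Ccl; apply/seteqP; split; first exact: sub_uO_limits.
move=> x [I [u [Cu ux]]].
have CI a b : C a -> C b -> C (Order.meet a b).
  by move=> Ca Cb; have [] := Clat a b Ca Cb.
have CU a b : C a -> C b -> C (Order.join a b).
  by move=> Ca Cb; have [] := Clat a b Ca Cb.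
have Ctrunc t j : C t -> C (Order.join (Order.meet x t) (Order.meet (u j) t)).
  move=> Ct; apply: Ccl (ux (Order.meet (u j) t) t (leIr _ _)) => i.
  by apply: CU; apply: CI.
have CmeetX t : C t -> C (Order.meet x t).
  move=> Ct; have := ux (Order.meet x t) t (leIr _ _).
  by rewrite joinxx; apply: Ccl => j; rewrite joinC; apply: Ctrunc.
have [[j _] _] := index_directed I.
have := ux (Order.meet x (u j)) x (leIl _ _).
rewrite meetxx (join_l (leIl _ _)); apply: Ccl => i.
by rewrite (meetC (u i)); apply: CU; apply: CmeetX.
Qed.

Lemma O_closed_meet_join (hL : infinitely_distributive L) C z :
  O_closed C ->
  O_closed [set x | C (Order.meet z x) /\ C (Order.join z x)].
Proof.
move=> /O_closedP Ccl; apply/O_closedP => I u x Pu ux; split.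
- by apply: Ccl (O_cvg_meet hL z ux) => i; case: (Pu i).
- by apply: Ccl (O_cvg_join hL z ux) => i; case: (Pu i).
Qed.

(** Meet and join are only shown O-continuous in each variable separately;
    closing up one variable at a time suffices. *)
Lemma O_closure_sublattice (hL : infinitely_distributive L) Y :
  sublattice Y -> sublattice (O_closure Y).
Proof.
move=> Ylat.
have YC : Y `<=` O_closure Y by exact: sub_gen_smallest.
pose stable z := [set x | O_closure Y (Order.meet z x) /\
                          O_closure Y (Order.join z x)].
have Cstable z : Y `<=` stable z -> O_closure Y `<=` stable z.
  by apply: smallest_sub; exact/O_closed_meet_join/O_closure_closed.
have YCstable y : Y y -> O_closure Y `<=` stable y.
  by move=> Yy; apply: Cstable => x Yx; have [] := Ylat y x Yy Yx; split; apply: YC.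
move=> x y Cx; apply: Cstable => {}y Yy.
by rewrite /stable /= meetC joinC; apply: YCstable.
Qed.

End Translations.

Theorem theorem12 (d : Order.disp_t) (L : latticeType d)
    (hL : infinitely_distributive L) (Y : set L) (hY : sublattice Y) :
  O_closure Y = uO_closure Y /\ sublattice (O_closure Y).
Proof.
have Clat := O_closure_sublattice hL hY.
split=> //; apply/seteqP; split; apply: smallest_sub.
- exact/(uO_closed_O_closed hL)/uO_closure_closed.
- exact: sub_gen_smallest.
- exact/(O_closed_sublattice_uO_closed Clat)/O_closure_closed.
- exact: sub_gen_smallest.
Qed.
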